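(* Let $G$ be a graph on $\{1,\dots,n\}$ and let $\mathbf c$ be a relative interior regular class critical point of a fixed hull and contact class $X=\mathcal F\cap\mathcal C(G)$. If $\mathbf c$ is second order unstable, then $\mathbf c$ is not a local minimiser of $\operatorname{Per}$ on $X$, modulo rigid motions.
   Context: $\mathcal D_n=\{\mathbf c\in(\mathbb R^2)^n:\|\mathbf c_i-\mathbf c_j\|\ge2\ \forall i\ne j\}$. For $\mathbf c\in\mathcal D_n$, $P(\mathbf c)=\operatorname{conv}\{\mathbf c_1,\dots,\mathbf c_n\}$ is the centre hull and $\operatorname{Per}(\mathbf c)$ is the length of the boundary of the convex hull of the union of the closed unit disks centred at $\mathbf c_1,\dots,\mathbf c_n$ (equal to $\operatorname{Per}(P(\mathbf c))+2\pi$). $\operatorname{Per}$ is invariant under rigid motions of the plane. For a graph $G$ on $\{1,\dots,n\}$ with edge set $E(G)$: $\mathcal C(G)$ is the set of $\mathbf c\in\mathcal D_n$ with $\|\mathbf c_i-\mathbf c_j\|=2$ exactly for $\{i,j\}\in E(G)$ (and $>2$ for non-edges); $M(G)=\{\mathbf d\in(\mathbb R^2)^n:\|\mathbf d_i-\mathbf d_j\|=2\ \forall\{i,j\}\in E(G)\}$; $\mathbf d\in M(G)$ is regular for $G$ if the gradients at $\mathbf d$ of $g_{ij}(\mathbf d)=\|\mathbf d_j-\mathbf d_i\|^2-4$, $\{i,j\}\in E(G)$, are linearly independent. $\mathbf c$ is hull stable if all configurations of $\mathcal D_n$ in some neighbourhood of $\mathbf c$ have a centre hull with the same set of hull vertex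 indices and the same cyclic order as $P(\mathbf c)$. For hull stable $\mathbf c\in\mathcal C(G)$ regular for $G$, let $\mathcal F$ be the set of configurations whose centre hull has the same hull vertex set and cyclic order as $P(\mathbf c)$, and let $\mathcal B$ be the list of oriented hull edges in cyclic order. A fixed hull and contact class is a set $X=\mathcal F\cap\mathcal C(G)$ of this form. A point $\mathbf c\in X$ is a relative interior regular point if it is regular for $G$ and there is an open neighbourhood $U_0$ of $\mathbf c$ in $(\mathbb R^2)^n$ with $\|\mathbf d_i-\mathbf d_j\|>2$ for all $\mathbf d\in U_0\cap M(G)$ and all $\{i,j\}\notin E(G)$, and $U_0\cap\mathcal D_n\subset\mathcal F$ (so that $X\cap U_0=M(G)\cap U_0$). $\widetilde{\operatorname{Per}}(\mathbf d)=\sum_{(p,q)\in\mathcal B}\|\mathbf d_q-\mathbf d_p\|+2\pi$, which is smooth near $\mathbf c$ and equals $\operatorname{Per}$ on $\mathcal F$; $D\operatorname{Per}(\mathbf c)$ denotes $D\widetilde{\operatorname{Per}}(\mathbf c)$. For $\{i,j\}\in E(G)$, $\mathbf u_{ij}=(\mathbf c_j-\mathbf c_i)/\|\mathbf c_j-\mathbf c_i\|$. The rolling space is $\mathbf{Roll}(\mathbf c)=\{\delta\mathbf c\in(\mathbb R^2)^n:\langle\mathbf u_{ij},\delta\mathbf c_j-\delta\mathbf c_i\rangle=0\ \forall\{i,j\}\in E(G)\}$. $\mathbf c$ is class critical if $D\operatorname{Per}(\mathbf c)[\eta]=0$ for every $\eta\in\mathbf{Roll}(\mathbf c)$. $R(\mathbf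 c)=\{(\mathbf a+\omega J\mathbf c_1,\dots,\mathbf a+\omega J\mathbf c_n):\mathbf a\in\mathbb R^2,\omega\in\mathbb R\}$ with $J(x,y)=(-y,x)$, and $\mathcal R_{\mathbf c}=\mathbf{Roll}(\mathbf c)\cap R(\mathbf c)^\perp$. For $\delta\mathbf c\in\mathbf{Roll}(\mathbf c)$ at a relative interior regular class critical point, $D^2\operatorname{Per}(\mathbf c)[\delta\mathbf c]=\frac{d^2}{dt^2}\big|_{t=0}\operatorname{Per}(\mathbf c(t))$ for any $C^2$ curve $\mathbf c(t)\subset X$ with $\mathbf c(0)=\mathbf c$, $\dot{\mathbf c}(0)=\delta\mathbf c$ (such curves exist and the value does not depend on the choice). $\mathbf c$ is second order unstable if there exists $0\neq\delta\mathbf c\in\mathcal R_{\mathbf c}$ with $D^2\operatorname{Per}(\mathbf c)[\delta\mathbf c]<0$. *)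

(* Defs.v *)
From HB Require Import structures.
From mathcomp Require Import all_boot all_order all_algebra.
From mathcomp Require Import all_classical all_reals all_analysis.

Set Implicit Arguments.
Unset Strict Implicit.
Unset Printing Implicit Defensive.

Import Order.TTheory GRing.Theory Num.Theory.
Import numFieldNormedType.Exports.

Local Open Scope classical_set_scope.
Local Open Scope ring_scope.

(* The library norm on 'rV_2 is the sup norm; it is only used here for the
   topology and for differentiation, and metric notions use [enorm]. *)
Section Plane.
Context {R : realType}.
Implicit Types (u v : 'rV[R]_2) (K C : set 'rV[R]_2).

Definition dot u v : R := (u *m v^T) 0 0.

Definition enorm u : R := Num.sqrt (dot u u).

Definition J u : 'rV[R]_2 := \row_k (if k == 0 then - u 0 1 else u 0 0).

Definition convex_hull K : set 'rV[R]_2 :=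
  smallest (@convex_set R 'rV[R]_2) K.

Definition extreme_point K u : Prop :=
  K u /\ forall v w (t : R), K v -> K w -> 0 < t < 1 ->
    u = t *: v + (1 - t) *: w -> v = u /\ w = u.

Definition boundary K : set 'rV[R]_2 := closure K `\` interior K.

Definition simple_closed_param (g : R -> 'rV[R]_2) C : Prop :=
  [/\ {within `[0, 1], continuous g}, set_inj `[0, 1[ g, g 0 = g 1 &
      g @` `[0, 1] = C].

Definition polygonal_length (g : R -> 'rV[R]_2) (s : seq R) : R :=
  let x := nth 1 (0 :: s) in
  \sum_(0 <= k < size s) enorm (g (x k.+1) - g (x k)).

Definition param_length (g : R -> 'rV[R]_2) : \bar R :=
  ereal_sup [set (polygonal_length g s)%:E | s in itv_partition 0 1].

(* Length of a rectifiable simple closed curve given as a point set; it does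
   not depend on the parametrization.  The value is 0 on other sets. *)
Definition curve_length C : R :=
  xget 0 [set L | exists g, simple_closed_param g C /\ param_length g = L%:E].

Definition closed_disk u : set 'rV[R]_2 := [set v | enorm (v - u) <= 1].

End Plane.

(* A configuration is an n x 2 matrix whose i-th row is the i-th centre, and a
   graph is a relation [e], assumed symmetric and irreflexive where used. *)
Section Configurations.
Context {R : realType} {n : nat}.
Implicit Types (c d eta : 'M[R]_(n, 2)) (e : rel 'I_n) (X : set 'M[R]_(n, 2)).

Definition cdist c (i j : 'I_n) : R := enorm (row j c - row i c).

Definition packings : set 'M[R]_(n, 2) :=
  [set c | forall i j, i != j -> 2 <= cdist c i j].

Definition centre_hull c : set 'rV[R]_2 := convex_hull (range (fun i => row i c)).

Definition Per c : R :=
  curve_length (boundary (convex_hull (\bigcup_i closed_disk (row i c)))).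

Definition contact_class e : set 'M[R]_(n, 2) :=
  [set c | packings c /\
     forall i j, i != j -> (cdist c i j = 2 <-> e i j)].

Definition contact_variety e : set 'M[R]_(n, 2) :=
  [set d | forall i j, e i j -> cdist d i j = 2].

Definition contact_fun (i j : 'I_n) d : R := cdist d i j ^+ 2 - 4.

Definition gradient (f : 'M[R]_(n, 2) -> R) d : 'M[R]_(n, 2) :=
  \matrix_(i, k) 'D_(delta_mx i k) f d.

Definition edges e : seq ('I_n * 'I_n) :=
  [seq p : 'I_n * 'I_n <- enum {: 'I_n * 'I_n} |
     (p.1 < p.2)%N && e p.1 p.2].

Definition regular e d : Prop :=
  free [seq gradient (contact_fun p.1 p.2) d | p <- edges e].

Definition hull_vertices c : set 'I_n :=
  [set i | extreme_point (centre_hull c) (row i c)].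

(* [(p, q)] is a hull edge traversed counterclockwise: the whole hull lies
   weakly to the left of the line from p to q.  When the hull is a segment,
   both orientations occur, so that the segment is counted twice. *)
Definition hull_edges c : set ('I_n * 'I_n) :=
  [set p | [/\ hull_vertices c p.1, hull_vertices c p.2, p.1 != p.2 &
     forall k, 0 <= dot (J (row p.2 c - row p.1 c)) (row k c - row p.1 c)]].

(* The cyclic order of the hull vertices is given by its successor relation,
   which is [hull_edges]. *)
Definition hull_class c : set 'M[R]_(n, 2) :=
  [set d | [/\ packings d, hull_vertices d = hull_vertices c &
               hull_edges d = hull_edges c]].

Definition hull_stable c : Prop :=
  \forall d \near c, packings d -> hull_class c d.

(* In the definitions below [c0] is the configuration defining the class. *)
Definition fixed_class e c0 : set 'M[R]_(n, 2) :=
  hull_class c0 `&` contact_class e.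

Definition relint_regular_point e c0 c : Prop :=
  [/\ fixed_class e c0 c, regular e c &
    exists U0 : set 'M[R]_(n, 2),
      [/\ open U0, U0 c,
          forall d, U0 d -> contact_variety e d ->
            forall i j, i != j -> ~~ e i j -> 2 < cdist d i j &
          U0 `&` packings `<=` hull_class c0]].

Definition smooth_Per c0 d : R :=
  \sum_(p : 'I_n * 'I_n | `[< hull_edges c0 p >]) cdist d p.1 p.2 + 2 * pi.

Definition contact_dir c (i j : 'I_n) : 'rV[R]_2 :=
  (cdist c i j)^-1 *: (row j c - row i c).

Definition Roll e c : set 'M[R]_(n, 2) :=
  [set eta | forall i j, e i j ->
     dot (contact_dir c i j) (row j eta - row i eta) = 0].

Definition class_critical e c0 c : Prop :=
  forall eta, Roll e c eta -> 'd (smooth_Per c0) c eta = 0.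

Definition inf_rigid c : set 'M[R]_(n, 2) :=
  [set d | exists (a : 'rV[R]_2) (w : R),
     forall i, row i d = a + w *: J (row i c)].

Definition orthogonal_compl X : set 'M[R]_(n, 2) :=
  [set d | forall r, X r -> \sum_i dot (row i d) (row i r) = 0].

Definition reduced_Roll e c : set 'M[R]_(n, 2) :=
  Roll e c `&` orthogonal_compl (inf_rigid c).

Definition C2_near0 (g : R -> 'M[R]_(n, 2)) : Prop :=
  \forall t \near (0 : R), [/\ derivable g t 1, derivable (g^`())%classic t 1 &
    {for t, continuous (g^`(2))%classic}].

(* At a relative interior regular class critical point, admissible curves exist
   for every rolling direction and all give the same value; the default 0 is
   returned when there is no admissible curve. *)
Definition D2Per X c eta : R :=
  xget 0 [set v | exists g : R -> 'M[R]_(n, 2),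
    [/\ C2_near0 g, \forall t \near (0 : R), X (g t), g 0 = c, (g^`())%classic 0 = eta &
        v = ((Per \o g)^`(2))%classic 0]].

Definition second_order_unstable e c0 c : Prop :=
  exists eta, [/\ eta != 0, reduced_Roll e c eta &
    D2Per (fixed_class e c0) c eta < 0].

(* d' is the image of d under an orientation preserving rigid motion. *)
Definition congruent d d' : Prop :=
  exists (a : 'rV[R]_2) (t : R),
    forall i, row i d' = a + (cos t *: row i d + sin t *: J (row i d)).

(* Local minimality of the class of c in the quotient of X by rigid motions:
   Per c is minimal among the d in X some congruent copy of which is near c. *)
Definition local_minimiser_mod_rigid X c : Prop :=
  \forall d' \near c, forall d, X d -> congruent d d' -> Per c <= Per d.

End Configurations.

(* Main.v *)
Require Import Defs.
From mathcomp Require Import all_boot all_order all_algebra.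
From mathcomp Require Import all_classical all_reals all_analysis.
From mathcomp Require Import ring lra.

Set Implicit Arguments.
Unset Strict Implicit.
Unset Printing Implicit Defensive.

Import Order.TTheory GRing.Theory Num.Theory.
Import numFieldNormedType.Exports.

Local Open Scope classical_set_scope.
Local Open Scope ring_scope.

(* Along an admissible curve g whose second derivative of f = Per o g is
   negative, local minimality of the class of g 0 gives f >= f 0 near 0.  As f
   has derivative 0 at 0 and its derivative has negative slope there, f is
   strictly decreasing on some ]0, d[, which contradicts f >= f 0 as soon as f
   is upper semicontinuous at 0.  The only geometric input is therefore
   this semicontinuity of Per.  The hull of the disks is the unit parallel
   body {D <= 1} of the hull of the centres, with D the distance to the
   latter.  If the centres of d are e/2-close to those of c, a homothety of ratio
   1 + e carries the body of c around the body of d; followed by the nearest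
   point projection onto the body of d, it is a (1 + e)-Lipschitz bijection
   between the two boundaries (injective because a parallel body has a unique
   normal at each boundary point).  It transports parametrizations, and the
   length of a simple closed curve does not depend on the parametrization, so
   Per d <= (1 + e) Per c. *)

(** * The Euclidean norm of the plane *)

Section Euclidean.
Context {R : realType}.
Implicit Types u v w : 'rV[R]_2.

Lemma dotE u v : dot u v = u 0 0 * v 0 0 + u 0 1 * v 0 1.
Proof.
rewrite /dot mxE big_ord_recl big_ord1 !mxE.
by do !congr (_ + _); congr (_ * _); congr (_ _ _); apply/val_inj.
Qed.

Lemma row2P u v : u 0 0 = v 0 0 -> u 0 1 = v 0 1 -> u = v.
Proof.
move=> h0 h1; apply/rowP => -[[|[|//]] hi].
  by have -> : Ordinal hi = 0 by exact/val_inj.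
by have -> : Ordinal hi = 1 by exact/val_inj.
Qed.

Lemma dot_ge0 u : 0 <= dot u u.
Proof. by rewrite dotE -!expr2 addr_ge0 ?sqr_ge0. Qed.

Lemma enorm_ge0 u : 0 <= enorm u. Proof. exact: sqrtr_ge0. Qed.

Lemma enorm_sqr u : enorm u ^+ 2 = dot u u.
Proof. by rewrite sqr_sqrtr ?dot_ge0. Qed.

Lemma enorm_le u (a : R) : 0 <= a -> (enorm u <= a) = (dot u u <= a ^+ 2).
Proof. by move=> a0; rewrite -enorm_sqr ler_pXn2r ?nnegrE ?enorm_ge0. Qed.

Lemma enormZ (a : R) u : enorm (a *: u) = `|a| * enorm u.
Proof.
rewrite /enorm -sqrtr_sqr -sqrtrM ?sqr_ge0//; congr Num.sqrt.
by rewrite !dotE !mxE; ring.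
Qed.

Lemma enorm0 : enorm (0 : 'rV[R]_2) = 0.
Proof. by rewrite -(scale0r (0 : 'rV[R]_2)) enormZ normr0 mul0r. Qed.

Lemma enormN u : enorm (- u) = enorm u.
Proof. by rewrite -scaleN1r enormZ normrN1 mul1r. Qed.

Lemma enormBC u v : enorm (u - v) = enorm (v - u).
Proof. by rewrite -opprB enormN. Qed.

Lemma dot_le_enorm u v : dot u v <= enorm u * enorm v.
Proof.
have [h|h] := leP (dot u v) 0.
  by apply: le_trans h _; rewrite mulr_ge0 ?enorm_ge0.
rewrite -(@ler_pXn2r _ 2)// ?nnegrE ?mulr_ge0 ?enorm_ge0 ?(ltW h)//.
rewrite exprMn !enorm_sqr !dotE -subr_ge0.
have := sqr_ge0 (u 0 0 * v 0 1 - u 0 1 * v 0 0); nra.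
Qed.

Lemma ler_enormD u v : enorm (u + v) <= enorm u + enorm v.
Proof.
rewrite enorm_le ?addr_ge0 ?enorm_ge0// sqrrD !enorm_sqr.
have := dot_le_enorm u v; rewrite !dotE !mxE; nra.
Qed.

Lemma enorm_triangle v u w : enorm (u - w) <= enorm (u - v) + enorm (v - w).
Proof. by rewrite -[u - w](subrKA v) ler_enormD. Qed.

Lemma enorm_eq0 u : enorm u = 0 -> u = 0.
Proof.
move=> /(congr1 (fun x => x ^+ 2)); rewrite enorm_sqr dotE expr0n/= => h.
by apply/row2P; rewrite !mxE; nra.
Qed.

Lemma enorm_le_norm u : enorm u <= 2 * `|u|.
Proof.
have h j : `|u 0 j| <= `|u|.
  by rewrite [leRHS]/Num.norm/= mx_normrE (le_trans _ (le_bigmax _ _ (0, j))).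
rewrite enorm_le ?mulr_ge0// dotE.
have := h 0; have := h 1; rewrite !ler_norml => /andP[? ?] /andP[? ?].
nra.
Qed.

Lemma norm_le_enorm u : `|u| <= enorm u.
Proof.
rewrite [leLHS]/Num.norm/= mx_normrE; apply: bigmax_le; rewrite ?enorm_ge0// => -[i j] _ /=.
rewrite (ord1 i) -(@ler_pXn2r _ 2)// ?nnegrE ?enorm_ge0// enorm_sqr real_normK ?num_real// dotE.
case: j => -[|[|//]] hj.
  have -> : Ordinal hj = 0 by exact/val_inj.
  by have := sqr_ge0 (u 0 1); nra.
have -> : Ordinal hj = 1 by exact/val_inj.
by have := sqr_ge0 (u 0 0); nra.
Qed.

(** Exchanging [x] and [y] turns the one-sided bound into a Lipschitz estimate; [enorm_le_norm]
    passes to the sup norm, which carries the topology. *)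
Lemma continuous_of_enorm_le (f : 'rV[R]_2 -> R) :
  (forall x y, f x <= enorm (x - y) + f y) -> continuous f.
Proof.
move=> fle x; apply/(@cvgrPdist_lt _ R^o _ (nbhs (x : 'rV[R]_2))) => e e0.
near=> y.
apply: (@le_lt_trans _ _ (enorm (x - y))).
  rewrite ler_norml; have := fle x y; have := fle y x.
  by rewrite (enormBC y x); lra.
apply: le_lt_trans (enorm_le_norm _) _; rewrite mulrC -ltr_pdivlMr//.
near: y; apply: cvgr_dist_lt => //; rewrite divr_gt0//.
Unshelve. all: by end_near. Qed.

Lemma enorm_continuous : continuous (@enorm R).
Proof.
by apply: continuous_of_enorm_le => x y; rewrite -{1}(subrK y x) ler_enormD.
Qed.

Lemma enorm_lipschitz_continuous (k : R) (f : 'rV[R]_2 -> 'rV[R]_2) :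
  (forall x y, enorm (f x - f y) <= k * enorm (x - y)) -> continuous f.
Proof.
move=> fk x; apply/(@cvgrPdist_lt _ 'rV[R]_2 _ (nbhs (x : 'rV[R]_2))) => e e0.
have k1 : 0 < `|k| + 1 by rewrite ltr_wpDl.
near=> y.
apply: le_lt_trans (norm_le_enorm _) _; apply: le_lt_trans (fk _ _) _.
apply: (@le_lt_trans _ _ ((`|k| + 1) * (2 * `|x - y|))).
  apply: le_trans (ler_wpM2l (ltW k1) (enorm_le_norm _)).
  by apply: ler_wpM2r; rewrite ?enorm_ge0// (le_trans (ler_norm _))// lerDl.
rewrite mulrA -ltr_pdivlMl ?mulr_gt0//.
near: y; apply: cvgr_dist_lt => //.
by rewrite mulr_gt0// invr_gt0 mulr_gt0.
Unshelve. all: by end_near. Qed.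

End Euclidean.

(** * Length of closed curves *)

Section Chains.
Context {R : realType}.
Implicit Types (g h : R -> 'rV[R]_2) (s : seq R).

(** The explicit starting point lets partitions be cut, joined and reversed by induction. *)
Fixpoint chain g (x : R) s : R :=
  if s is y :: s' then enorm (g y - g x) + chain g y s' else 0.

Lemma polygonal_lengthE g s : polygonal_length g s = chain g 0 s.
Proof.
suff H x : \sum_(0 <= k < size s)
    enorm (g (nth 1 (x :: s) k.+1) - g (nth 1 (x :: s) k)) = chain g x s.
  exact: H.
elim: s x => [|y s IHs] x /=; first by rewrite big_geq.
by rewrite big_nat_recl//= IHs.
Qed.

Lemma chain_ge0 g x s : 0 <= chain g x s.
Proof. by elim: s x => //= y s IHs x; rewrite addr_ge0// enorm_ge0. Qed.

Lemma chain_cat g x s1 s2 :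
  chain g x (s1 ++ s2) = chain g x s1 + chain g (last x s1) s2.
Proof. by elim: s1 x => [|y s IHs] x /=; rewrite ?add0r// IHs addrA. Qed.

Lemma chain_rev g x s : chain g (last x s) (rev (belast x s)) = chain g x s.
Proof.
elim: s x => //= y s IHs x; rewrite rev_cons -cats1 chain_cat IHs /= addr0 addrC.
by congr (_ + _); rewrite enormBC; case: s {IHs} => //= z s; rewrite rev_cons last_rcons.
Qed.

Lemma chain_lipschitz (k : R) (f : 'rV[R]_2 -> 'rV[R]_2) g x s :
  (forall u v, enorm (f u - f v) <= k * enorm (u - v)) ->
  chain (f \o g) x s <= k * chain g x s.
Proof.
move=> fk; elim: s x => [|y s IHs] x /=; first by rewrite mulr0.
by rewrite mulrDr lerD.
Qed.

Lemma chain_map g h (f : R -> R) x s :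
  {in x :: s, h \o f =1 g} -> chain g x s = chain h (f x) (map f s).
Proof.
elim: s x => //= y s IHs x hg.
rewrite -!hg ?inE ?eqxx ?orbT//= IHs// => z zs.
by apply: hg; rewrite inE zs orbT.
Qed.

Lemma strict_chain g x s : path <=%R x s ->
  exists s', [/\ path <%R x s', last x s' = last x s & chain g x s' = chain g x s].
Proof.
elim: s x => [|y s IHs] x /=; first by exists [::].
move=> /andP[xy /IHs[s' [ps ls cs]]]; move: xy; rewrite le_eqVlt => /orP[/eqP ->|xy].
  by exists s'; rewrite subrr enorm0 add0r.
by exists (y :: s'); rewrite /= xy ls cs.
Qed.

(** Completing the list by [0] and [1] only adds nonnegative terms and, once repetitions are
    removed, gives a partition. *)
Lemma param_length_ge g (L : R) x s : param_length g = L%:E ->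
  0 <= x -> path <=%R x s -> last x s <= 1 -> chain g x s <= L.
Proof.
move=> gL x0 ps l1; apply: (@le_trans _ _ (chain g 0 (rcons (x :: s) 1))).
  by rewrite /= -cats1 chain_cat/= addr0 addrCA lerDl addr_ge0// enorm_ge0.
have [|s' [ps' ls' <-]] := @strict_chain g 0 (rcons (x :: s) 1).
  by rewrite rcons_path/= x0 ps l1.
rewrite -lee_fin -gL; apply: ereal_sup_ubound; exists s' => //=.
  by split => //; rewrite ls' last_rcons.
by rewrite polygonal_lengthE.
Qed.

Lemma param_length_le g (b : R) :
  (forall s, path <%R 0 s -> last 0 s = 1 -> chain g 0 s <= b) ->
  exists2 L : R, param_length g = L%:E & L <= b.
Proof.
move=> gb.
have ub : (param_length g <= b%:E)%E.
  apply: ge_ereal_sup => _ [s [ps /eqP ls] <-].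
  by rewrite lee_fin polygonal_lengthE gb.
have lb : (0%:E <= param_length g)%E.
  apply: (@le_trans _ _ (polygonal_length g [:: 1])%:E).
    by rewrite lee_fin polygonal_lengthE chain_ge0.
  by apply: ereal_sup_ubound; exists [:: 1] => //; split => /=; rewrite ?ltr01.
move: ub lb; case: (param_length g) => [L| |]//; rewrite !lee_fin => Lb _.
by exists L.
Qed.

End Chains.

(** * Moving the base point of a closed curve *)

Section CurveLength.
Context {R : realType}.
Implicit Types (g h : R -> 'rV[R]_2) (C : set 'rV[R]_2) (s : seq R).

Lemma within_continuous_precomp (U V W : topologicalType) (A : set U) (B : set V)
    (f : V -> U) (g : U -> W) :
  continuous f -> (forall x, B x -> A (f x)) ->
  {within A, continuous g} -> {within B, continuous (g \o f)}.
Proof.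
move=> cf BA /subspace_continuousP cg; apply/subspace_continuousP => x Bx.
apply: cvg_trans (cg _ (BA _ Bx)) => P; rewrite /= /nbhs/= /within/= => gP.
have := cf x _ gP; rewrite /nbhs/=; apply: filterS => z /= hz Bz.
exact/hz/BA.
Qed.

Lemma path_le_split (m x : R) s : path <=%R x s -> x <= m -> exists s1 s2,
  [/\ s = s1 ++ s2, path <=%R x (rcons s1 m), path <=%R m s2 &
      all (fun y => y <= m) s1].
Proof.
elim: s x => [|y s IHs] x /=; first by exists [::], [::]; rewrite /= andbT.
move=> /andP[xy ps] xm; have [ym|/ltW my] := leP y m; last first.
  by exists [::], (y :: s); rewrite /= xm my.
have [s1 [s2 [-> p1 p2 a1]]] := IHs _ ps ym.
by exists (y :: s1), s2; rewrite /= xy ym.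
Qed.

Lemma chain_cat_le g x (m : R) s1 s2 :
  chain g x (s1 ++ s2) <= chain g x (rcons s1 m) + chain g m s2.
Proof.
rewrite -cats1 !chain_cat -addrA lerD2l; case: s2 => [|y s2] /=.
  by rewrite !addr0 enorm_ge0.
by rewrite addr0 addrA lerD2r addrC enorm_triangle.
Qed.

(** Run [h] from [a] to [1], then from [0] to [a]. A partition for [h'] is cut at [1 - a]; its two
    pieces, translated and exchanged, form a chain of [h]. *)
Lemma simple_closed_param_shift h C (a : R) :
  simple_closed_param h C -> 0 <= a < 1 -> exists h',
    [/\ simple_closed_param h' C, h' 0 = h a &
        forall b : R, param_length h = b%:E ->
          exists2 L : R, param_length h' = L%:E & L <= b].
Proof.
move=> [ch ih h01 hC] /andP[a0 a1].
pose h' x := if x <= 1 - a then h (x + a) else h (x + a - 1).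
(* The two branches agree at [1 - a] because [h 0 = h 1]. *)
have h'r x : 1 - a <= x -> h' x = h (x + a - 1).
  rewrite /h' le_eqVlt => /orP[/eqP <-|]; last by rewrite ltNge => /negbTE ->.
  by rewrite lexx subrK subrr h01.
exists h'; split; first split.
- have -> : `[0, 1]%classic = `[0, 1 - a] `|` `[1 - a, 1] :> set R.
    apply/seteqP; split => x /=; rewrite !in_itv/=.
      by move=> /andP[-> ->]; have [|/ltW ->] := leP x (1 - a); [left|right].
    by case => /andP[x0 x1]; apply/andP; split; lra.
  apply: withinU_continuous; [exact: itv_closed|exact: itv_closed| |].
    apply: (@subspace_eq_continuous _ _ _ (h \o +%R^~ a) h').
      by move=> x; rewrite inE/= in_itv/= /h' => /andP[_ ->].
    apply: within_continuous_precomp ch => [x|x /=].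
      by apply: cvgD; [exact: cvg_id|exact: cvg_cst].
    by rewrite !in_itv/=; lra.
  apply: (@subspace_eq_continuous _ _ _ (h \o +%R^~ (a - 1)) h').
    by move=> x; rewrite inE/= in_itv/= => /andP[? _]; rewrite h'r// addrA.
  apply: within_continuous_precomp ch => [x|x /=].
    by apply: cvgD; [exact: cvg_id|exact: cvg_cst].
  by rewrite !in_itv/=; lra.
(* Here [1 - a] goes to the second branch, so that [w] stays in [[0, 1[], where [h] is injective. *)
- pose w x := if x < 1 - a then x + a else x + a - 1.
  have h'w x : h' x = h (w x).
    rewrite /w; case: ltP => xa; last by rewrite h'r.
    by rewrite /h' ltW.
  have w01 x : x \in `[0, 1[%classic -> w x \in `[0, 1[%classic.
    by rewrite !inE/= !in_itv/= /w; case: (ltP x (1 - a)); lra.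
  move=> x y xI yI; rewrite !h'w => /ih - /(_ (w01 _ xI) (w01 _ yI)).
  move: xI yI; rewrite !inE/= !in_itv/= /w.
  by case: (ltP x (1 - a)); case: (ltP y (1 - a)); lra.
- rewrite {1}/h' h'r; last by lra.
  by rewrite ifT; [congr h|]; lra.
- rewrite -hC; apply/seteqP; split => _ [x /= + <-]; rewrite in_itv/= => xI.
    rewrite /h'; case: leP => xa.
      by exists (x + a) => //=; rewrite in_itv/=; lra.
    by exists (x + a - 1) => //=; rewrite in_itv/=; lra.
  have [ax|xa] := leP a x.
    exists (x - a); rewrite ?in_itv/=; first lra.
    by rewrite /h' ifT ?subrK//; lra.
  exists (x + 1 - a); rewrite ?in_itv/=; first lra.
  by rewrite h'r; [congr h|]; lra.
- by rewrite /h' ifT ?add0r//; lra.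
move=> b hb; apply: param_length_le => s ps ls.
have [s1 [s2 [def_s p1 p2 sm]]] : exists s1 s2,
    [/\ s = s1 ++ s2, path <=%R 0 (rcons s1 (1 - a)), path <=%R (1 - a) s2 &
        all (fun y => y <= 1 - a) s1].
  apply: path_le_split; last by lra.
  by apply: sub_path ps => ? ? /ltW.
rewrite def_s (le_trans (chain_cat_le _ _ (1 - a) _ _))//.
rewrite (@chain_map _ _ h (+%R^~ a) 0) ?add0r; last first.
  move=> x xs /=; rewrite /h' ifT//; move: xs.
  rewrite inE mem_rcons inE => /or3P[/eqP->|/eqP->//|/(allP sm)//]; lra.
rewrite (@chain_map _ _ h (+%R^~ (a - 1)) (1 - a)); last first.
  move=> x xs /=; rewrite h'r ?addrA//; move: xs; rewrite inE => /orP[/eqP->//|].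
  by apply/allP; apply: order_path_min p2 => ? ? ?; exact: le_trans.
have -> : 1 - a + (a - 1) = 0 :> R by ring.
set t1 := map _ _; set t2 := map _ _.
(* The segment joining the two pieces only adds length. *)
apply: (@le_trans _ _ (chain h 0 (t2 ++ a :: t1))).
  by rewrite chain_cat/= addrC lerD2l lerDr enorm_ge0.
apply: (param_length_ge hb) => //; last first.
  by rewrite last_cat/= /t1 map_rcons last_rcons subrK.
have homo_add (k x : R) t : path <=%R x t -> path <=%R (x + k) (map (+%R^~ k) t).
  by apply: homo_path => ? ? ?; rewrite lerD2r.
rewrite cat_path/=; apply/and3P; split.
- by have := homo_add (a - 1) _ _ p2; rewrite (_ : 1 - a + (a - 1) = 0)//; ring.
- have -> : 0 = (1 - a) + (a - 1) :> R by ring.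
  rewrite /t2 (last_map (+%R^~ (a - 1))).
  suff : last (1 - a) s2 <= 1 by lra.
  by move: ls; rewrite def_s last_cat; case: (s2) => /= [_|? ? ->//]; lra.
- by have := homo_add a _ _ p1; rewrite add0r.
Qed.

End CurveLength.

(** * Two parametrizations with the same base point *)

Section CurveLengthUnique.
Context {R : realType}.
Implicit Types (g h : R -> 'rV[R]_2) (C : set 'rV[R]_2) (s : seq R).

(* The change of parameter between two parametrizations with the same base
   point; at the end points it may exchange 0 and 1, so it is only described on
   the open interval. *)
Lemma simple_closed_param_mono g h C :
  simple_closed_param g C -> simple_closed_param h C -> g 0 = h 0 ->
  exists2 f : R -> R, {in `]0, 1[, forall x, (f x \in `]0, 1[) /\ h (f x) = g x} &
    unstable.strict_monotonic (`]0, 1[ : interval R) f.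
Proof.
move=> [cg ig g01 gC] [ch ih h01 hC] gh0.
have /choice[f fP] : forall x, exists y, x \in `]0, 1[ -> (y \in `]0, 1[) /\ h y = g x.
  move=> x; have [xI|xI] := boolP (x \in `]0, 1[); last by exists 0 => xI'; rewrite xI' in xI.
  have : C (g x).
    by rewrite -gC; exists x => //=; move: xI; rewrite !in_itv/=; lra.
  rewrite -hC => -[y /= yI hy]; exists y => _; split=> //.
  have gx0 : g x <> g 0.
    move=> /ig; rewrite !inE/= !in_itv/= => H; move: xI; rewrite in_itv/= => xI.
    by have := H ltac:(lra) ltac:(lra); lra.
  have y0 : y != 0 by apply/eqP => y0; apply: gx0; rewrite -hy y0.
  have y1 : y != 1 by apply/eqP => y1; apply: gx0; rewrite -hy y1 -h01.
  by move: yI; rewrite !in_itv/= !lt_neqAle eq_sym y0 y1.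
(* Injectivity of [h] covers [[0, 1[]; [y = 1] would force [f x = 0]. *)
have hf x y : x \in `]0, 1[ -> y \in `[0, 1] -> h y = h (f x) -> y = f x.
  move=> xI yI; have [fI _] := fP _ xI; move: (fI) (yI); rewrite !in_itv/= => fI' yI'.
  have [->|y1] := eqVneq y 1.
    by rewrite -h01 => /ih; rewrite !inE/= !in_itv/= => H; have := H ltac:(lra) ltac:(lra); lra.
  apply: ih; rewrite !inE/= !in_itv/=; last by lra.
  by rewrite lt_neqAle y1/=; lra.
exists f => //; apply: itv_continuous_inj_mono; last first.
  move=> x y xI yI fxy; apply: ig.
  - by move: xI; rewrite inE in_itv/= => ?; rewrite in_itv/=; lra.
  - by move: yI; rewrite inE in_itv/= => ?; rewrite in_itv/=; lra.
  - by rewrite -(fP _ xI).2 -(fP _ yI).2 fxy.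
rewrite continuous_open_subspace; last exact: itv_open.
move=> x; rewrite inE/= => xI.
have gx : {for x, continuous g}.
  by have /(continuous_within_itvP _ ltr01)[/(_ _ xI)] := cg.
move=> U; rewrite nbhsE => -[B [Bo Bfx] BU].
pose D := `]0, 1[%classic `&` B.
have Do : open D by apply: openI => //; exact: itv_open.
(* The complement of D is mapped by h to a compact set that avoids g x. *)
pose K := h @` (`[0, 1] `&` ~` D).
have Kc : closed K.
  apply: compact_closed; first exact: norm_hausdorff.
  apply: continuous_compact.
    by apply: continuous_subspaceW ch; exact: subIsetl.
  apply: compact_closedI; first exact: segment_compact.
  exact: open_closedC.
have Kgx : (~` K) (g x).
  move=> [y [yI yD] hy]; apply: yD.
  have -> : y = f x by apply: hf => //; rewrite hy (fP _ xI).2.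
  by split => //; have [] := fP _ xI.
have nK : nbhs x (g @^-1` ~` K) by apply: gx; apply: open_nbhs_nbhs; split => //; exact: closed_openC.
have nI : nbhs x `]0, 1[%classic by apply: open_nbhs_nbhs; split => //; exact: itv_open.
apply: filterS2 nK nI => z zK zI; apply: BU.
apply: contrapT => Bfz; apply: zK; exists (f z); last exact: (fP _ zI).2.
split; last by move=> [].
by have [+ _] := fP _ zI; rewrite /= !in_itv/=; lra.
Qed.

(** The change of parameter sends a partition for [g] to a monotone list for [h] through the same
    points, to be read backwards if the change is decreasing. *)
Lemma aligned_param_length_le g h C (b : R) :
  simple_closed_param g C -> simple_closed_param h C -> g 0 = h 0 ->
  param_length h = b%:E -> exists2 L : R, param_length g = L%:E & L <= b.
Proof.
move=> gC hC gh0 hb; have [f fP fmono] := simple_closed_param_mono gC hC gh0.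
have [_ _ g01 _] := gC; have [_ _ h01 _] := hC.
apply: param_length_le => s ps ls.
have [s' def_s] : exists s', s = rcons s' 1.
  by case/lastP: s ls {ps} => [/esym/eqP|s y]; rewrite ?oner_eq0// last_rcons => ->; exists s.
move: ps; rewrite def_s rcons_path => /andP[ps' s'1].
have sI : {in s', forall x, x \in `]0, 1[}.
  move=> x xs; rewrite in_itv/=; apply/andP; split.
    by have /allP -> := order_path_min lt_trans ps'.
  apply: (@le_lt_trans _ _ (last 0 s')) => //.
  case/splitPr: xs ps' => p1 p2; rewrite cat_path last_cat/= => /and3P[_ _].
  have := mem_last x p2; rewrite inE => /orP[/eqP->//|lp] p.
  by rewrite ltW// (allP (order_path_min lt_trans p)).
(* [f] is only controlled inside, so [k] prescribes the end values: the identity in the increasing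
   case, [1 - x] in the decreasing one. Both are consistent since [h 0 = h 1]. *)
pose F (k : R -> R) x := if x \in `]0, 1[ then f x else k x.
have FE k x : x \in `[0, 1] -> [\/ x = 0 /\ F k x = k 0, x = 1 /\ F k x = k 1 |
    (x \in `]0, 1[) /\ F k x = f x].
  rewrite /F in_itv/= => x01; have [xI|] := boolP (x \in `]0, 1[); first by constructor 3.
  rewrite in_itv/= => xI; have [->|x1] := eqVneq x 1; first by constructor 2.
  constructor 1; suff -> : x = 0 by [].
  by apply/eqP; move: xI; rewrite !lt_neqAle; case: (x == 1) x1 => //=; lra.
have sI' : {in 0 :: rcons s' 1, forall x, x \in `[0, 1]}.
  move=> x; rewrite inE mem_rcons inE => /or3P[/eqP->|/eqP->|/sI];
    by rewrite !in_itv/=; lra.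
have psle : path <=%R 0 (rcons s' 1).
  by apply: (@sub_path _ <%R) => [? ? /ltW//|]; rewrite rcons_path ps'.
have chainF (k : R -> R) : h (k 0) = h 0 -> h (k 1) = h 0 ->
    chain g 0 (rcons s' 1) = chain h (F k 0) (map (F k) (rcons s' 1)).
  move=> k0 k1; apply: chain_map => x /sI' /(FE k)[[-> /= ->]|[-> /= ->]|[xI /= ->]].
  - by rewrite k0.
  - by rewrite k1 -gh0.
  - by have [] := fP _ xI.
have f01 x : x \in `]0, 1[ -> 0 < f x < 1.
  by move=> /fP[]; rewrite in_itv.
have F0 k : F k 0 = k 0 by rewrite /F in_itv/= ltxx.
have F1 k : F k 1 = k 1 by rewrite /F in_itv/= ltxx andbF.
have all01 : all [in `[0, 1]] (0 :: rcons s' 1) by exact/allP.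
case: fmono => fmono.
- rewrite (chainF id)// F0; apply: (param_length_ge hb) => //; last first.
    by rewrite -{1}(F0 id) last_map last_rcons F1.
  rewrite -{1}(F0 id); apply: (homo_path_in _ all01) psle.
  move=> x y /(FE id) Fx /(FE id) Fy; rewrite le_eqVlt => /orP[/eqP->//|xy].
  case: Fx xy => -[xE ->]; case: Fy => -[yE ->] xy; rewrite ?xE ?yE//;
  first [exact/ltW/fmono | by move: xy; rewrite xE yE; lra |
    by have := f01 _ xE; rewrite in_itv/= in xE; lra |
    by have := f01 _ yE; rewrite in_itv/= in yE; lra].
(* The transported list descends from [1] to [0]; [chain_rev] turns it round. *)
- rewrite (chainF (fun x => 1 - x)) ?subr0 ?subrr// F0 subr0 -chain_rev.
  have lF : last 1 (map (F (fun x => 1 - x)) (rcons s' 1)) = 0.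
    by rewrite map_rcons last_rcons F1 subrr.
  rewrite lF; apply: (param_length_ge hb) => //; last first.
    by rewrite map_rcons belast_rcons rev_cons last_rcons.
  rewrite -{1}lF rev_path -{1}(subr0 1) -{1}(F0 (fun x => 1 - x)).
  apply: (homo_path_in _ all01) psle.
  move=> x y /(FE (fun x => 1 - x)) Fx /(FE (fun x => 1 - x)) Fy.
  rewrite le_eqVlt => /orP[/eqP->//|xy].
  case: Fx xy => -[xE ->]; case: Fy => -[yE ->] xy; rewrite ?xE ?yE//;
  first [exact/ltW/fmono | by move: xy; rewrite xE yE; lra |
    by have := f01 _ xE; rewrite in_itv/= in xE; lra |
    by have := f01 _ yE; rewrite in_itv/= in yE; lra].
Qed.

End CurveLengthUnique.

(** * Independence of the parametrization, and Lipschitz maps *)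

Section CurveLengthComparison.
Context {R : realType}.
Implicit Types (g h : R -> 'rV[R]_2) (C : set 'rV[R]_2).

Lemma simple_closed_param_length_le g h C (b : R) :
  simple_closed_param g C -> simple_closed_param h C ->
  param_length h = b%:E -> exists2 L : R, param_length g = L%:E & L <= b.
Proof.
move=> gC hC hb; have [_ _ _ gimg] := gC; have [_ _ h01 himg] := hC.
have : C (g 0) by rewrite -gimg; exists 0 => //=; rewrite in_itv/= lexx ler01.
rewrite -himg => -[a0 /= a0I ha0].
(* The shift needs [a < 1], so the parameter [1] is replaced by [0]. *)
have [a a01 ha] : exists2 a : R, 0 <= a < 1 & h a = g 0.
  have [a1|a1] := eqVneq a0 1; first by exists 0; rewrite ?lexx ?ltr01// h01 -a1.
  by exists a0 => //; move: a0I; rewrite in_itv/= (lt_neqAle a0) a1.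
have [h' [h'C h'0 /(_ _ hb)[b' h'b' b'b]]] := simple_closed_param_shift hC a01.
have [|L gL Lb'] := aligned_param_length_le gC h'C _ h'b'; first by rewrite h'0 ha.
by exists L => //; exact: le_trans b'b.
Qed.

(** Whichever parametrization [xget] picks, comparing it with [g] in both directions gives the same
    length. *)
Lemma curve_lengthE g C (L : R) : simple_closed_param g C ->
  param_length g = L%:E -> curve_length C = L.
Proof.
move=> gC gL; rewrite /curve_length; case: xgetP => [y _ [h [hC hL']]|/(_ L)[]]; last first.
  by exists g.
have [L1] := simple_closed_param_length_le gC hC hL'.
have [L2] := simple_closed_param_length_le hC gC gL.
rewrite hL' gL => -[<-] ? -[<-] ?; apply/eqP; rewrite eq_le; apply/andP; split => //.
Qed.

Lemma simple_closed_param_comp g C C' (f : 'rV[R]_2 -> 'rV[R]_2) (k L : R) :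
  0 <= k ->
  (forall u v, enorm (f u - f v) <= k * enorm (u - v)) -> set_bij C C' f ->
  simple_closed_param g C -> param_length g = L%:E ->
  simple_closed_param (f \o g) C' /\
  exists2 L' : R, param_length (f \o g) = L'%:E & L' <= k * L.
Proof.
move=> k0 fk [fC finj fsurj] [cg ig g01 gC] gL; split; last first.
  apply: param_length_le => s ps ls; apply: le_trans (chain_lipschitz _ _ _ fk) _.
  apply: ler_wpM2l => //; apply: (param_length_ge gL) => //; last by rewrite ls.
  by apply: sub_path ps => ? ? /ltW.
have Cg x : x \in `[0, 1[%classic -> g x \in C.
  rewrite !inE/= in_itv/= => x01; rewrite -gC; exists x => //=.
  by rewrite in_itv/=; lra.
split.
- apply: within_continuous_comp cg => x _; exact: enorm_lipschitz_continuous fk x.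
- by move=> x y xI yI /finj fxy; apply: ig => //; apply: fxy; exact: Cg.
- by rewrite /= g01.
- rewrite -image_comp gC; apply/seteqP; split => // _ [x Cx <-]; exact: fC.
Qed.

(** The map [f'] deals with the default value: if [C] has no parametrization of finite length, its
    [curve_length] is [0], and [f'] shows that [C'] has none either. *)
Lemma curve_length_le C C' (f f' : 'rV[R]_2 -> 'rV[R]_2) (k k' : R) :
  0 <= k -> (forall u v, enorm (f u - f v) <= k * enorm (u - v)) ->
  set_bij C C' f ->
  0 <= k' -> (forall u v, enorm (f' u - f' v) <= k' * enorm (u - v)) ->
  set_bij C' C f' ->
  curve_length C' <= k * curve_length C.
Proof.
move=> k0 fk fC k'0 fk' fC'.
rewrite [in leRHS]/curve_length; case: xgetP => [y _ [g [gC gL]]|noC].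
  have [fgC [L' fgL L'le]] := simple_closed_param_comp k0 fk fC gC gL.
  by rewrite (curve_lengthE fgC fgL).
rewrite mulr0 /curve_length; case: xgetP => [y _ [g [gC gL]]|//].
have [fgC [L' fgL L'le]] := simple_closed_param_comp k'0 fk' fC' gC gL.
by case: (noC L'); exists (f' \o g).
Qed.

End CurveLengthComparison.

(** * Parallel bodies *)

Section Projection.
Context {R : realType}.
Implicit Types (P : set 'rV[R]_2) (f q : 'rV[R]_2 -> 'rV[R]_2) (u v w x y : 'rV[R]_2).

(** The obtuse angle inequality, which characterizes the nearest point map onto a convex set. *)
Definition projection P f : Prop := forall x,
  P (f x) /\ forall y, P y -> dot (x - f x) (y - f x) <= 0.

(** Adding the two obtuse angle inequalities bounds the square of [enorm (f x - f y)] by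
    [dot (x - y) (f x - f y)]; Cauchy-Schwarz concludes. *)
Lemma projection_contraction P f x y :
  projection P f -> enorm (f x - f y) <= 1 * enorm (x - y).
Proof.
move=> Pf; have [fx /(_ _ (Pf y).1) hx] := Pf x; have [fy /(_ _ fx) hy] := Pf y.
rewrite mul1r; have [->|d0] := eqVneq (enorm (f x - f y)) 0; first exact: enorm_ge0.
have {}d0 : 0 < enorm (f x - f y) by rewrite lt_neqAle eq_sym d0 enorm_ge0.
rewrite -(ler_pM2r d0) -expr2 enorm_sqr.
apply: le_trans (dot_le_enorm (x - y) (f x - f y)).
by move: hx hy; rewrite !dotE !mxE; nra.
Qed.

Lemma projection_unique P f x y : projection P f -> P y ->
  (forall w, P w -> dot (x - y) (w - y) <= 0) -> y = f x.
Proof.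
move=> /(_ x)[fx hx] Py hy; have := hx _ Py; have := hy _ fx => h1 h2.
apply/subr0_eq/enorm_eq0; apply/eqP; rewrite eq_le enorm_ge0 andbT enorm_le//.
by move: h1 h2; rewrite expr0n/= !dotE !mxE; nra.
Qed.

Lemma projection_min P f x y : projection P f -> P y ->
  enorm (x - f x) <= enorm (x - y).
Proof.
move=> /(_ x)[fx hx] /hx h; rewrite enorm_le ?enorm_ge0// enorm_sqr.
have := dot_ge0 (y - f x); move: h; rewrite !dotE !mxE; nra.
Qed.

End Projection.

(** * Distance function and boundary of a parallel body *)

Section ParallelBody.
Context {R : realType} (P : set 'rV[R]_2) (q : 'rV[R]_2 -> 'rV[R]_2).
Context (Pq : projection P q).
Context (Pconv : forall x y (t : R), P x -> P y -> 0 <= t <= 1 ->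
  P (t *: x + (1 - t) *: y)).
Implicit Types (u v w x y : 'rV[R]_2).

Definition pdist x : R := enorm (x - q x).

Definition parallel_body : set 'rV[R]_2 := [set x | pdist x <= 1].

Lemma pdist_ge0 x : 0 <= pdist x. Proof. exact: enorm_ge0. Qed.

Lemma pdist_le x y : P y -> pdist x <= enorm (x - y).
Proof. exact: projection_min. Qed.

Lemma pdist_lipschitz x y : pdist x <= enorm (x - y) + pdist y.
Proof. by apply: le_trans (pdist_le _ (Pq y).1) _; exact: enorm_triangle. Qed.

Lemma pdist_convex x y (t : R) : 0 <= t <= 1 ->
  pdist (t *: x + (1 - t) *: y) <= t * pdist x + (1 - t) * pdist y.
Proof.
move=> t01; apply: le_trans (pdist_le _ (Pconv (Pq x).1 (Pq y).1 t01)) _.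
have -> : t *: x + (1 - t) *: y - (t *: q x + (1 - t) *: q y) =
    t *: (x - q x) + (1 - t) *: (y - q y) by rewrite !scalerBr opprD addrACA.
apply: le_trans (ler_enormD _ _) _; rewrite !enormZ !ger0_norm//; lra.
Qed.

(** The obtuse angle inequality at the foot [q x] survives scaling [x - q x] by [r]. *)
Lemma projection_ray x (r : R) : 0 <= r -> q (q x + r *: (x - q x)) = q x.
Proof.
move=> r0; apply/esym/(projection_unique Pq) => [|w Pw]; first exact: (Pq x).1.
have := (Pq x).2 _ Pw; rewrite !dotE !mxE; nra.
Qed.

Lemma pdist_ray x (r : R) : 0 <= r -> pdist (q x + r *: (x - q x)) = r * pdist x.
Proof.
by move=> r0; rewrite /pdist projection_ray// addrAC subrr add0r enormZ ger0_norm.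
Qed.

Definition body_projection x : 'rV[R]_2 :=
  if pdist x <= 1 then x else q x + (pdist x)^-1 *: (x - q x).

(** For [x] outside, let [u] be the unit vector along [x - q x]. If [y] is in the body,
    [dot u (y - q y) <= 1] and [dot u (q y - q x) <= 0], so [y] lies behind the supporting line at
    [q x + u]. *)
Lemma projection_body : projection parallel_body body_projection.
Proof.
move=> x; rewrite /body_projection; case: leP => [x1|x1].
  by split => // y _; rewrite subrr dotE !mxE !mul0r addr0.
have d0 : 0 < pdist x by exact: lt_trans x1.
split; first by rewrite /parallel_body/= pdist_ray ?invr_ge0 ?(ltW d0)// mulVf ?gt_eqF//.
move=> y; rewrite /parallel_body/= => y1.
set u := (pdist x)^-1 *: (x - q x).
have u1 : enorm u = 1 by rewrite /u enormZ gtr0_norm ?invr_gt0// mulVf ?gt_eqF.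
have xE : x - q x = pdist x *: u by rewrite scalerA mulfV ?gt_eqF// scale1r.
have h1 := (Pq x).2 _ (Pq y).1.
have h2 := dot_le_enorm u (y - q y).
have uu : dot u u = 1 by rewrite -enorm_sqr u1 expr1n.
have h3 : dot u (q y - q x) <= 0.
  by rewrite -(pmulr_rle0 _ d0); move: h1; rewrite xE !dotE !mxE; nra.
have -> : x - (q x + u) = (pdist x - 1) *: u.
  by rewrite opprD addrA xE scalerBl scale1r.
have h4 : dot u (y - (q x + u)) <= 0.
  rewrite u1 mul1r in h2; have := le_trans h2 y1.
  by move: h3 uu; rewrite !dotE !mxE; nra.
have -> : dot ((pdist x - 1) *: u) (y - (q x + u)) = (pdist x - 1) * dot u (y - (q x + u)).
  by rewrite !dotE !mxE; ring.
by rewrite mulr_ge0_le0// subr_ge0 ltW.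
Qed.

Lemma parallel_body_convex x y (t : R) : parallel_body x -> parallel_body y ->
  0 <= t <= 1 -> parallel_body (t *: x + (1 - t) *: y).
Proof.
rewrite /parallel_body/= => x1 y1 t01; apply: le_trans (pdist_convex _ _ t01) _.
have := pdist_ge0 x; have := pdist_ge0 y; nra.
Qed.

Lemma pdist_continuous : continuous pdist.
Proof. exact: continuous_of_enorm_le pdist_lipschitz. Qed.

(** Where [pdist] is below 1, continuity gives a neighbourhood; where it equals 1, moving outwards
    along the normal ray leaves the body at once. *)
Lemma boundary_parallel_body : boundary parallel_body = [set x | pdist x = 1].
Proof.
have Kc : closed parallel_body.
  by apply: closed_comp (@closed_le R 1) => x _; exact: pdist_continuous.
rewrite /boundary -(closure_id _).1//; apply/seteqP; split => x /=.
  move=> [x1 xint]; apply/eqP; rewrite eq_le x1/= leNgt; apply/negP => x1'; apply: xint.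
  have : open (pdist @^-1` [set r | r < 1]).
    by apply: open_comp (@open_lt R 1) => y _; exact: pdist_continuous.
  by rewrite openE => /(_ _ x1'); apply: filterS => y /ltW.
move=> x1; split; first by rewrite /parallel_body/= x1.
rewrite /interior => /= xint.
have ray : {for 0, continuous (fun t : R => q x + (1 + t) *: (x - q x))}.
  move=> /=; apply: cvgD; first exact: cvg_cst.
  apply: cvgZr_tmp; apply: cvgD; first exact: cvg_cst. exact: cvg_id.
have := ray parallel_body; rewrite addr0 scale1r addrC subrK => /(_ xint) near0.
have : \forall t \near (0 : R), t <= 0.
  near=> t; rewrite leNgt; apply/negP => t0.
  have : parallel_body (q x + (1 + t) *: (x - q x)) by near: t.
  rewrite /parallel_body/= pdist_ray ?x1 ?mulr1; last by rewrite addr_ge0// ltW.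
  by lra.
move=> /nbhs_ballP[e /= e0] /(_ (e / 2)); rewrite /ball/= sub0r normrN gtr0_norm ?divr_gt0//.
by move=> /(_ _); lra.
Unshelve. all: by end_near. Qed.

End ParallelBody.

(** * Bijection between the boundaries of two parallel bodies *)

Section BodyBijection.
Context {R : realType} (P Q : set 'rV[R]_2) (qP qQ : 'rV[R]_2 -> 'rV[R]_2).
Context (Pq : projection P qP) (Qq : projection Q qQ).
Context (Qconv : forall x y (t : R), Q x -> Q y -> 0 <= t <= 1 ->
  Q (t *: x + (1 - t) *: y)).
Context (M : R) (Qbounded : forall x, Q x -> enorm x <= M).
Context (p : 'rV[R]_2) (k : R) (k0 : 0 < k).
Context (inside : forall x, pdist qP x <= 1 -> pdist qQ (p + k^-1 *: (x - p)) < 1).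
Implicit Types x y z : 'rV[R]_2.

Let dilate x := p + k *: (x - p).
Let contract x := p + k^-1 *: (x - p).

Let dilateK : cancel dilate contract.
Proof.
move=> x; rewrite /contract /dilate [p + k *: _]addrC addrK scalerA mulVf ?gt_eqF//.
by rewrite scale1r addrC subrK.
Qed.

Let contractK : cancel contract dilate.
Proof.
move=> x; rewrite /contract /dilate [p + k^-1 *: _]addrC addrK scalerA mulfV ?gt_eqF//.
by rewrite scale1r addrC subrK.
Qed.

Let contract_conv (t : R) x y :
  contract (t *: x + (1 - t) *: y) = t *: contract x + (1 - t) *: contract y.
Proof. by apply/row2P; rewrite !mxE; ring. Qed.

Let pdist_dilate y : pdist qQ y = 1 -> 1 < pdist qP (dilate y).
Proof.
move=> y1; rewrite ltNge; apply/negP => /inside.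
by rewrite -/(contract _) dilateK y1 ltxx.
Qed.

(** By [inside] the contracted foot has distance below 1, and [r < 1] gives it positive weight in
    the convexity inequality. *)
Let pdist_contract_lt x z (r : R) : pdist qP (qP z) <= 1 -> 0 <= r < 1 ->
  pdist qQ (contract x) = 1 ->
  pdist qQ (contract (r *: x + (1 - r) *: qP z)) < 1.
Proof.
move=> z1 r01 x1; rewrite contract_conv.
have r01' : 0 <= r <= 1 by lra.
apply: le_lt_trans (pdist_convex Qq Qconv _ _ r01') _.
have := inside z1; rewrite -/(contract _) x1; nra.
Qed.

(** Injectivity: dilated points with the same image lie on one ray from a common foot; if they
    differ, the nearer is a proper convex combination of the foot and the farther, so it contracts
    strictly inside the body of [Q]. Surjectivity: the intermediate value theorem along the normal
    ray through [z]. *)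
Lemma body_projection_bij :
  set_bij [set y | pdist qQ y = 1] [set x | pdist qP x = 1]
    (fun y => body_projection qP (p + k *: (y - p))).
Proof.
have fE y : pdist qQ y = 1 -> body_projection qP (dilate y) =
    qP (dilate y) + (pdist qP (dilate y))^-1 *: (dilate y - qP (dilate y)).
  by move=> /pdist_dilate y1; rewrite /body_projection leNgt y1.
have q1 z : pdist qP (qP z) <= 1.
  by rewrite (le_trans (pdist_le Pq _ (Pq z).1))// subrr enorm0.
split.
- move=> y /= y1; rewrite -/(dilate y) fE//.
  have d1 := pdist_dilate y1; have d0 : 0 < pdist qP (dilate y) by exact: lt_trans d1.
  by rewrite (pdist_ray Pq) ?invr_ge0 ?(ltW d0)// mulVf ?gt_eqF.
- have qf y : pdist qQ y = 1 -> qP (body_projection qP (dilate y)) = qP (dilate y).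
    by move=> y1; rewrite fE// (projection_ray Pq)// invr_ge0 enorm_ge0.
  have fray y : pdist qQ y = 1 -> dilate y = qP (dilate y) +
      pdist qP (dilate y) *: (body_projection qP (dilate y) - qP (dilate y)).
    move=> y1; rewrite fE// [X in _ *: (X - _)]addrC addrK scalerA mulfV ?scale1r.
      by rewrite addrC subrK.
    by rewrite gt_eqF// (lt_trans _ (pdist_dilate y1)).
  have no y y' : pdist qQ y = 1 -> pdist qQ y' = 1 ->
      body_projection qP (dilate y) = body_projection qP (dilate y') ->
      ~ pdist qP (dilate y) < pdist qP (dilate y').
    move=> y1 y'1 ff' dd'; have := qf _ y'1; rewrite -ff' (qf _ y1) => qq'.
    have d0' : 0 < pdist qP (dilate y') by exact: lt_trans (pdist_dilate y'1).
    pose r := pdist qP (dilate y) / pdist qP (dilate y').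
    have r01 : 0 <= r < 1.
      by rewrite ltr_pdivrMr// mul1r dd' divr_ge0// enorm_ge0.
    have := pdist_contract_lt (q1 (dilate y)) r01 _ (x := dilate y').
    rewrite dilateK => /(_ y'1); rewrite (_ : _ + _ = dilate y) ?dilateK ?y1 ?ltxx//.
    rewrite [in RHS]fray// [in LHS]fray// -qq' -ff'.
    set u := body_projection _ _ - _; rewrite scalerDr scalerA divfK ?gt_eqF//.
    by rewrite addrAC -scalerDl [r + _]addrC subrK scale1r.
  move=> y y'; rewrite !inE/= -!/(dilate _) => y1 y'1 ff'.
  have dd' : pdist qP (dilate y) = pdist qP (dilate y').
    have := no _ _ y1 y'1 ff'; have := no _ _ y'1 y1 (esym ff') => /negP + /negP.
    by rewrite -!leNgt => h1 h2; apply/eqP; rewrite eq_le h1 h2.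
  apply: (can_inj dilateK); rewrite (fray y)// [RHS]fray// -dd' -ff'.
  by rewrite -(qf y')// -ff' qf.
- move=> z /= z1.
  pose ray (r : R) := qP z + r *: (z - qP z).
  have cray : continuous (fun r => pdist qQ (contract (ray r))).
    move=> r; apply: continuous_comp; last exact: pdist_continuous.
    apply: cvgD; first exact: cvg_cst.
    apply: cvgZl_tmp; apply: cvgD; last exact: cvg_cst.
    apply: cvgD; first exact: cvg_cst.
    by apply: cvgZr_tmp; exact: cvg_id.
  pose w := p + k^-1 *: (qP z - p).
  (* The contraction of [ray r1] is at distance [k^-1 + 1 + M + enorm w] from [w], hence at distance
     at least 1 from [Q], whose points have norm at most [M]. *)
  pose r1 := 1 + k * (1 + M + enorm w).
  have M0 : 0 <= M by exact: le_trans (enorm_ge0 _) (Qbounded (Qq z).1).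
  have w0 := enorm_ge0 w.
  have r11 : 1 <= r1 by rewrite lerDl mulr_ge0 ?(ltW k0)//; lra.
  have ray1 : ray 1 = z by rewrite /ray scale1r addrC subrK.
  have lo : pdist qQ (contract (ray 1)) < 1 by rewrite ray1 inside ?z1.
  have hi : 1 <= pdist qQ (contract (ray r1)).
    have e1 := ler_enormD (contract (ray r1)) (- w); rewrite enormN in e1.
    have e2 := ler_enormD (contract (ray r1) - qQ (contract (ray r1))) (qQ (contract (ray r1))).
    have := Qbounded (Qq (contract (ray r1))).1; rewrite /pdist.
    rewrite subrK in e2.
    have : enorm (contract (ray r1) - w) = k^-1 * r1.
      have -> : contract (ray r1) - w = (k^-1 * r1) *: (z - qP z).
        by apply/row2P; rewrite !mxE; ring.
      rewrite enormZ -/(pdist qP z) z1 mulr1 ger0_norm// mulr_ge0 ?invr_ge0 ?(ltW k0)//; lra.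
    have -> : k^-1 * r1 = k^-1 + 1 + M + enorm w by rewrite /r1; field; rewrite gt_eqF.
    have : 0 < k^-1 by rewrite invr_gt0.
    lra.
  have [||r rI yr] := @IVT R (fun r => pdist qQ (contract (ray r))) 1 r1 1 r11.
  - exact: continuous_subspaceT.
  - by rewrite ge_min le_max hi (ltW lo) orbT.
  exists (contract (ray r)) => //.
  rewrite -/(dilate _) contractK /body_projection.
  have r1' : 1 <= r by move: rI; rewrite in_itv/= => /andP[].
  have r0 : 0 < r by exact: lt_le_trans r1'.
  (* If [body_projection] fixes the point, then [r <= 1], so [r = 1] and the point is [z]. *)
  rewrite (pdist_ray Pq) ?(ltW r0)// z1 mulr1; case: ifP => rle.
    by rewrite (_ : r = 1) ?ray1//; apply/eqP; rewrite eq_le rle r1'.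
  rewrite (projection_ray Pq) ?(ltW r0)// /ray [X in _ *: (X - _)]addrC addrK.
  by rewrite scalerA mulVf ?gt_eqF// scale1r addrC subrK.
Qed.

End BodyBijection.

(** * The perimeter of a configuration *)

Section CentrePoints.
Context {R : realType} {n : nat}.
Implicit Types (c d : 'M[R]_(n, 2)) (l : 'rV[R]_n) (x y : 'rV[R]_2).

Definition weights : set 'rV[R]_n :=
  [set l | (forall i, 0 <= l 0 i) /\ \sum_i l 0 i = 1].

(** The hull of the centres as the image of a simplex: compactness yields nearest points, and one
    weight vector serves two configurations. *)
Definition centre_points c : set 'rV[R]_2 := [set l *m c | l in weights].

Lemma weights_conv l l' (t : R) : weights l -> weights l' -> 0 <= t <= 1 ->
  weights (t *: l + (1 - t) *: l').
Proof.
move=> [l0 l1] [l'0 l'1] /andP[t0 t1]; split.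
  by move=> i; rewrite !mxE addr_ge0// mulr_ge0// subr_ge0.
under eq_bigr do rewrite !mxE.
by rewrite big_split/= -!mulr_sumr l1 l'1; ring.
Qed.

Lemma centre_points_conv c x y (t : R) : centre_points c x -> centre_points c y ->
  0 <= t <= 1 -> centre_points c (t *: x + (1 - t) *: y).
Proof.
move=> [l lw <-] [l' l'w <-] t01; exists (t *: l + (1 - t) *: l').
  exact: weights_conv.
by rewrite mulmxDl -!scalemxAl.
Qed.

Lemma delta_weights (i : 'I_n) : weights (delta_mx 0 i).
Proof.
split=> [j|]; first by rewrite mxE ler0n.
rewrite (bigD1 i)//= !mxE !eqxx big1 ?addr0// => j ji.
by rewrite mxE (negbTE ji) andbF.
Qed.

Lemma row_centre_points c (i : 'I_n) : centre_points c (row i c).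
Proof. by exists (delta_mx 0 i); [exact: delta_weights|rewrite rowE]. Qed.

Lemma weights_enorm_le c l (e : R) : weights l ->
  (forall i, enorm (row i c) <= e) -> enorm (l *m c) <= e.
Proof.
move=> [l0 l1] ce; have -> : e = \sum_i l 0 i * e by rewrite -mulr_suml l1 mul1r.
rewrite mulmx_sum_row.
elim/big_ind2 : _ => [|x r y r' xr yr'|i _]; first by rewrite enorm0.
  by apply: le_trans (ler_enormD _ _) _; exact: lerD.
by rewrite enormZ ger0_norm// ler_wpM2l.
Qed.

Lemma lin_row_continuous (V : normedModType R) (a : 'I_n -> V) :
  continuous (fun l : 'rV[R]_n => \sum_i l 0 i *: a i).
Proof.
move=> l.
have := @cvg_big V 'I_n +%R 0 xpredT (@add_continuous V) 'rV[R]_n (nbhs l) (index_enum 'I_n)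
  (fun i (l' : 'rV[R]_n) => l' 0 i *: a i) (fun i => l 0 i *: a i) _.
apply => i _.
by apply: cvgZr_tmp; exact: coord_continuous.
Qed.

Lemma weights_compact : compact weights.
Proof.
have -> : weights = [set l : 'rV[R]_n | forall i, `[0, 1]%classic (l 0 i)] `&`
    [set l | \sum_i l 0 i *: (1 : R^o) = 1].
  apply/seteqP; split => l /=; under [X in X = 1]eq_bigr do rewrite [_ *: _]mulr1.
    move=> [l0 l1]; split => // i; rewrite in_itv/= l0/= -l1 (bigD1 i)//= lerDl.
    by rewrite sumr_ge0.
  by move=> [l01 l1]; split => // i; have := l01 i; rewrite in_itv/= => /andP[].
apply: compact_closedI.
  have H := @rV_compact R n (fun=> `[0, 1]%classic) (fun=> @segment_compact R 0 1).
  exact: H.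
apply: (@closed_comp _ _ (fun l : 'rV[R]_n => \sum_i l 0 i *: (1 : R^o)) [set r | r = 1]).
  by move=> l _; exact: (@lin_row_continuous R^o (fun=> 1)).
exact: closed_eq.
Qed.

(** Minimise the distance to [x] over the simplex; if the obtuse angle inequality failed at the
    minimiser, moving towards [w] would come closer to [x]. *)
Lemma centre_points_projection c (i0 : 'I_n) :
  exists q, projection (centre_points c) q.
Proof.
suff /choice[q qP] : forall x, exists y, centre_points c y /\
    forall w, centre_points c w -> dot (x - y) (w - y) <= 0 by exists q.
move=> x; pose F (l : 'rV[R]_n) := enorm (x - l *m c).
have cF : continuous F.
  have -> : F = @enorm R \o (fun l => x - \sum_i l 0 i *: row i c).
    by apply/funext => l; rewrite /F/= mulmx_sum_row.
  move=> l.
  apply: (@continuous_comp 'rV[R]_n 'rV[R]_2 R^o _ (@enorm R)); last exact: enorm_continuous.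
  apply: (@cvgB _ 'rV[R]_2 _ (nbhs l) _ (fun=> x)); first exact: cvg_cst.
  exact: (@lin_row_continuous 'rV[R]_2 (fun i => row i c)).
have [|l0] := compact_EVT_min _ weights_compact (continuous_subspaceT cF).
  by exists (delta_mx 0 i0); exact: delta_weights.
rewrite inE => l0w l0min; exists (l0 *m c); split; first by exists l0.
move=> _ [l lw <-]; set y := l0 *m c; set w := l *m c.
rewrite leNgt; apply/negP => A0.
pose A := dot (x - y) (w - y); pose B := dot (w - y) (w - y).
have B0 : 0 <= B by exact: dot_ge0.
have AB : 0 < A + B by rewrite ltr_pwDl.
(* Moving by [t] changes the squared distance by [t * (t * B - 2 * A)]; this [t] is at most 1 and
   gives [t * B <= A], so the change is negative. *)
pose t := A / (A + B).
have t0 : 0 < t by rewrite divr_gt0.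
have t01 : 0 <= t <= 1 by rewrite ltW//= ler_pdivrMr// mul1r lerDl.
have := l0min (t *: l + (1 - t) *: l0); rewrite inE => /(_ (weights_conv lw l0w t01)).
rewrite /F mulmxDl -!scalemxAl -/w -/y enorm_le ?enorm_ge0// enorm_sqr.
have tAB : t * (A + B) = A by rewrite divfK ?gt_eqF.
rewrite -subr_ge0 (_ : _ - _ = t * (t * B - 2 * A)).
  rewrite pmulr_rge0//.
  have : 0 <= A by exact: ltW. nra.
by rewrite /A /B !dotE !mxE; ring.
Qed.

End CentrePoints.

(** * Comparison of the perimeters of close configurations *)

Section PerimeterComparison.
Context {R : realType} {n : nat}.
Implicit Types (c d : 'M[R]_(n, 2)) (l : 'rV[R]_n) (x y : 'rV[R]_2).

Lemma convex_setE (K : set 'rV[R]_2) :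
  @convex_set R 'rV[R]_2 K <-> forall x y (t : R), K x -> K y -> 0 <= t <= 1 ->
    K (t *: x + (1 - t) *: y).
Proof.
split=> [Kc x y t Kx Ky /andP[t0 t1]|Kc x y t].
  have t01 : Itv.spec (@Itv.num_sem R) (Itv.Real `[0%Z, 1%Z]) t.
    by rewrite /= /Itv.num_sem/= in_itv/= num_real t0 t1.
  have := Kc x y (Itv.mk t01); rewrite !inE; exact.
rewrite !inE => Kx Ky; apply: (Kc x y t%:num Kx Ky).
by apply/andP; split.
Qed.

(** Induction on the list of indices, each partial sum being divided by its total weight so that it
    is itself a convex combination. *)
Lemma convex_set_sum (K : set 'rV[R]_2) l (v : 'I_n -> 'rV[R]_2) :
  @convex_set R 'rV[R]_2 K -> weights l -> (forall i, K (v i)) ->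
  K (\sum_i l 0 i *: v i).
Proof.
move=> /convex_setE Kc [l0 l1] Kv.
suff H (s : seq 'I_n) : 0 < \sum_(i <- s) l 0 i ->
    K ((\sum_(i <- s) l 0 i)^-1 *: \sum_(i <- s) l 0 i *: v i).
  by have := H (index_enum _); rewrite l1 invr1 scale1r; apply.
elim: s => [|i s IHs]; first by rewrite big_nil ltxx.
rewrite !big_cons; set S := \sum_(j <- s) l 0 j.
have S0 : 0 <= S by rewrite sumr_ge0.
have [S00|Sn0] := eqVneq S 0.
  rewrite S00 addr0 => li; rewrite [X in _ + X]big1_seq.
    by rewrite addr0 scalerA mulVf ?gt_eqF// scale1r.
  have /allP lS : all (fun j => true ==> (l 0 j == 0)) s.
    by rewrite -psumr_eq0// -/S S00.
  by move=> j /andP[_ /lS/=/eqP ->]; rewrite scale0r.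
move=> SS; have {}S0 : 0 < S by rewrite lt_neqAle eq_sym Sn0.
have := Kc (v i) _ (l 0 i / (l 0 i + S)) (Kv i) (IHs S0); rewrite -/S.
set T := l 0 i + S in SS *.
have T0 : T != 0 by rewrite gt_eqF.
rewrite scalerDr !scalerA [T^-1 * _]mulrC.
have -> : (1 - l 0 i / T) * S^-1 = T^-1.
  by rewrite /T; field; rewrite Sn0 T0.
apply; rewrite divr_ge0 ?(ltW SS)//= ler_pdivrMr// mul1r lerDl; exact: ltW.
Qed.

(** A point [x] of the body is the combination giving [q x], with every centre translated by
    [x - q x], which keeps it in its disk. *)
Lemma convex_hull_disks c q : projection (centre_points c) q ->
  convex_hull (\bigcup_i closed_disk (row i c)) = parallel_body q.
Proof.
move=> cq; apply/seteqP; split.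
  apply: smallest_sub.
    by apply/convex_setE => x y t; apply: parallel_body_convex => //; exact: centre_points_conv.
  move=> x [i _]; rewrite /closed_disk/= => xi; rewrite /parallel_body/=.
  by apply: le_trans (pdist_le cq _ (row_centre_points c i)) xi.
move=> x xq K [Kc diskK].
have [l lw lq] := (cq x).1.
have -> : x = \sum_i l 0 i *: (row i c + (x - q x)).
  under eq_bigr do rewrite scalerDr.
  by rewrite big_split/= -mulmx_sum_row lq -scaler_suml lw.2 scale1r addrC subrK.
apply: convex_set_sum => // i; apply: diskK; exists i => //.
by rewrite /closed_disk/= [row i c + _]addrC addrK.
Qed.

Lemma Per_pdist c q : projection (centre_points c) q ->
  Per c = curve_length [set x | pdist q x = 1].
Proof.
move=> cq; rewrite /Per (convex_hull_disks cq) (boundary_parallel_body cq)//.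
Qed.

Lemma close_configurations_inside c d qc qd (i : 'I_n) (e : R) :
  projection (centre_points c) qc -> projection (centre_points d) qd ->
  0 < e -> (forall j, enorm (row j c - row j d) <= e / 2) ->
  forall x, pdist qc x <= 1 -> pdist qd (row i d + (1 + e)^-1 *: (x - row i d)) < 1.
Proof.
move=> cq dq e0 cd x xc.
have k0 : 0 < 1 + e by lra.
have [l lw lq] := (cq x).1.
set p := row i d; pose k := (1 + e)^-1.
have kv : 0 < k by rewrite invr_gt0.
have k1 : k * (1 + e) = 1 by rewrite mulVf ?gt_eqF.
have k01 : 0 <= k <= 1 by nra.
(* Compare with the point of the hull of [d] that has the weights of [qc x], contracted about [p];
   the difference has norm at most [(1 + e / 2) / (1 + e)]. *)
apply: le_lt_trans (pdist_le dq _ (centre_points_conv _ (row_centre_points d i) k01)) _.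
  by exists l.
have -> : p + k *: (x - p) - (k *: (l *m d) + (1 - k) *: p) =
    k *: ((x - qc x) + l *m (c - d)).
  by rewrite mulmxBr lq; apply/row2P; rewrite !mxE; ring.
rewrite enormZ gtr0_norm//.
have := ler_enormD (x - qc x) (l *m (c - d)).
have : enorm (l *m (c - d)) <= e / 2.
  by apply: weights_enorm_le => // j; rewrite linearB; exact: cd.
by move: xc; rewrite /pdist; nra.
Qed.

(** The closeness hypothesis is symmetric, so the dilation and projection are available both ways,
    as [curve_length_le] requires; each dilation is centred at row [i] of its source. *)
Lemma Per_le c d (i : 'I_n) (e : R) : 0 < e ->
  (forall j, enorm (row j c - row j d) <= e / 2) -> Per d <= (1 + e) * Per c.
Proof.
move=> e0 cd; have [qc cq] := centre_points_projection c i.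
have [qd dq] := centre_points_projection d i.
have k0 : 0 < 1 + e by lra.
have dc j : enorm (row j d - row j c) <= e / 2 by rewrite enormBC.
have bounded (a : 'M[R]_(n, 2)) : forall x, centre_points a x -> enorm x <= \sum_j enorm (row j a).
  move=> _ [l lw <-]; apply: weights_enorm_le => // j.
  by rewrite (bigD1 j)//= lerDl sumr_ge0// => ? _; exact: enorm_ge0.
have lip (a : 'M[R]_(n, 2)) q (p : 'rV[R]_2) : projection (centre_points a) q -> forall u v,
    enorm (body_projection q (p + (1 + e) *: (u - p)) -
           body_projection q (p + (1 + e) *: (v - p))) <= (1 + e) * enorm (u - v).
  move=> aq u v; apply: le_trans (projection_contraction _ _ (projection_body aq)) _.
  have -> : p + (1 + e) *: (u - p) - (p + (1 + e) *: (v - p)) = (1 + e) *: (u - v).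
    by apply/row2P; rewrite !mxE; ring.
  by rewrite mul1r enormZ gtr0_norm.
have bij (b : 'M[R]_(n, 2)) P qa qb Pa Qb := @body_projection_bij R P _ qa qb Pa Qb
  (@centre_points_conv R n b) _ (bounded b) (row i b) _ k0.
rewrite (Per_pdist cq) (Per_pdist dq).
apply: (curve_length_le (ltW k0) (lip d _ (row i c) dq) _ (ltW k0) (lip c _ (row i d) cq)).
  apply: bij => //; exact: (close_configurations_inside _ dq cq).
apply: bij => //; exact: (close_configurations_inside _ cq dq).
Qed.

End PerimeterComparison.

(** * Second order condition *)

Section SecondDerivative.
Context {R : realType}.
Implicit Types f : R -> R.

(* Off its domain of existence the library derivative takes the value 0. *)
Lemma derive1_neq0_derivable f (t : R) : f^`()%classic t != 0 -> derivable f t 1.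
Proof.
apply: contra_neqP => fN; rewrite derive1E /derive /lim /lim_in getPN// => l fl.
by apply: fN; apply/cvg_ex; exists l.
Qed.

Lemma derive1_neq0_cvg f (t : R) : f^`()%classic t != 0 ->
  h^-1 *: (f (h + t) - f t) @[h --> 0^'] --> f^`()%classic t.
Proof.
move=> f't0; apply: contrapT => fN; move/eqP: f't0; apply.
rewrite /derive1 /lim /lim_in getPN// => l fl; apply: fN.
by rewrite /derive1; apply: (cvgP l fl).
Qed.

Lemma derivable1_continuous f (t : R) : derivable f t 1 -> {for t, continuous f}.
Proof. by move=> /derivable1_diffP/differentiable_continuous. Qed.

Lemma near0_ball (P : R -> Prop) : (\forall t \near (0 : R), P t) ->
  exists2 e : R, 0 < e & forall t, `|t| < e -> P t.
Proof.
move=> /nbhs_ballP[e /= e0 eP]; exists e => // t te; apply: eP.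
by rewrite /ball/= sub0r normrN.
Qed.

(** If the derivative at 0 were nonzero, its continuity would keep it nonzero nearby, so [f] would
    be derivable there and the rule for interior minima would apply. *)
Lemma local_min_derive1_eq0 f : derivable f^`()%classic 0 1 ->
  (\forall t \near (0 : R), f 0 <= f t) -> f^`()%classic 0 = 0.
Proof.
move=> df' fmin; apply/eqP/negPn/negP => f'0.
have n0 : \forall t \near (0 : R), f^`()%classic t != 0.
  exact: cvgr_neq0 (derivable1_continuous df') f'0.
have [e e0 eP] := near0_ball (filterI fmin n0).
have eI t : t \in `]- e, e[ -> f 0 <= f t /\ derivable f t 1.
  rewrite in_itv/= -ltr_norml => /eP[fle /derive1_neq0_derivable df]; by split.
have I0 : 0 \in `]- e, e[ by rewrite in_itv/=; lra.
have [|t /eI[]//||t /eI[]//|_] := @derive1_at_min R f (- e) e 0; [lra|by []|].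
by rewrite -derive1E; apply/eqP.
Qed.

(** The derivative vanishes at 0 with negative slope, so it is negative just to the right; being
    nonzero there, it also certifies derivability. *)
Lemma second_derivative_lt0_decreasing f : f^`(2)%classic 0 < 0 ->
  (\forall t \near (0 : R), f 0 <= f t) ->
  exists2 e : R, 0 < e & {in `]0, e[ &, {homo f : x y /~ x < y}}.
Proof.
move=> f2 fmin; have df' : derivable f^`()%classic 0 1.
  by apply: derive1_neq0_derivable; rewrite lt_eqF.
have f'0 := local_min_derive1_eq0 df' fmin.
have : \forall h \near 0^', h^-1 *: (f^`()%classic (h + 0) - f^`()%classic 0) < 0.
  have f2n0 : f^`()^`()%classic 0 != 0 by rewrite lt_eqF.
  exact: cvgr_lt (derive1_neq0_cvg f2n0) _ f2.
move=> /nbhs_ballP[e /= e0 eP]; exists e => //.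
have f'lt0 t : t \in `]0, e[ -> f^`()%classic t < 0.
  rewrite in_itv/= => /andP[t0 te].
  have := eP t; rewrite /ball/= sub0r normrN gtr0_norm// => /(_ te).
  rewrite gt_eqF// => /(_ isT); rewrite f'0 subr0 addr0.
  by rewrite pmulr_rlt0 ?invr_gt0.
have df t : t \in `]0, e[ -> derivable f t 1.
  by move=> /f'lt0 ft; apply: derive1_neq0_derivable; rewrite lt_eqF.
apply: ltr0_derive1_lt_oo => // t; rewrite inE => /df; exact: derivable1_continuous.
Qed.

(** For small [t > 0] one gets [f 0 <= f t1 < f (t1 / 2) < f t], a jump at 0 that semicontinuity
    forbids. *)
Lemma second_derivative_lt0_not_min f : f^`(2)%classic 0 < 0 ->
  (forall e, 0 < e -> \forall t \near (0 : R), f t <= (1 + e) * f 0) ->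
  ~ (\forall t \near (0 : R), f 0 <= f t).
Proof.
move=> f2 fusc fmin; have [e e0 fdecr] := second_derivative_lt0_decreasing f2 fmin.
have [r r0 rP] := near0_ball fmin.
pose t1 := Num.min e r / 2.
have m0 : 0 < Num.min e r by rewrite lt_min e0 r0.
have me : Num.min e r <= e by rewrite ge_min lexx.
have mr : Num.min e r <= r by rewrite ge_min lexx orbT.
have t10 : 0 < t1 by rewrite divr_gt0.
have f1 : f 0 <= f t1 by apply: rP; rewrite gtr0_norm// /t1; lra.
have f21 : f t1 < f (t1 / 2).
  by apply: fdecr; rewrite ?in_itv/= /t1; lra.
(* This factor times [f 0] stays below the jump; the [+ 1] covers [f 0 = 0]. *)
have k0 : 0 < (f (t1 / 2) - f t1) / (`|f 0| + 1).
  by rewrite divr_gt0 ?subr_gt0// ltr_wpDl.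
have [s s0 sP] := near0_ball (fusc _ k0).
(* The quarter puts [t] below both [t1 / 2] and [s]. *)
pose t := Num.min t1 s / 4.
have n0 : 0 < Num.min t1 s by rewrite lt_min t10 s0.
have n1 : Num.min t1 s <= t1 by rewrite ge_min lexx.
have ns : Num.min t1 s <= s by rewrite ge_min lexx orbT.
have t0 : 0 < t by rewrite divr_gt0.
have f12 : f (t1 / 2) < f t.
  by apply: fdecr; rewrite ?in_itv/= /t /t1 in n1 *; lra.
have ts : t < s by rewrite /t; lra.
have := sP t; rewrite gtr0_norm// => /(_ ts).
rewrite mulrDl mul1r -lerBlDl leNgt => /negP; apply.
rewrite mulrAC ltr_pdivrMr ?ltr_wpDl//.
have := ler_norm (f 0); have := normr_ge0 (f 0); nra.
Qed.

End SecondDerivative.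

(** * Instability excludes local minimality *)

Lemma norm_row_le (R : realType) (m n : nat) (A : 'M[R]_(m, n)) (i : 'I_m) :
  `|row i A| <= `|A|.
Proof.
rewrite [leLHS]/Num.norm/= mx_normrE; apply: bigmax_le => // -[k j] _ /=.
by rewrite mxE [leRHS]/Num.norm/= mx_normrE (le_trans _ (le_bigmax _ _ (i, j))).
Qed.

Theorem proposition5p7 (R : realType) (n : nat) (e : rel 'I_n)
    (c0 c : 'M[R]_(n, 2))
    (e_sym : symmetric e) (e_irr : irreflexive e)
    (c0_stable : hull_stable c0) (c0_contact : contact_class e c0)
    (c0_regular : regular e c0)
    (c_relint : relint_regular_point e c0 c)
    (c_critical : class_critical e c0 c)
    (c_unstable : second_order_unstable e c0 c) :
  ~ local_minimiser_mod_rigid (fixed_class e c0) c.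
Proof.
case: c_unstable => eta [eta0 _]; rewrite /D2Per.
(* The default value [0] is not negative, so instability supplies an admissible curve [g]. *)
case: xgetP => [v _ [g [C2g Xg g0 _ ->]] Perg2 cmin|_]; last by rewrite ltxx.
(* [Per_le] needs an index; there is one because [eta] is nonzero. *)
have [i _|no_i] := pickP 'I_n; last first.
  by move/eqP: eta0; apply; apply/matrixP => i; have := no_i i.
have [dg _ _] := nbhs_singleton C2g.
have gc : {for 0, continuous g} by exact/differentiable_continuous/derivable1_diffP.
apply: (second_derivative_lt0_not_min Perg2) => [k k0|].
  (* One factor 2 passes from the sup norm to [enorm], the other is the [e / 2] of [Per_le]. *)
  have k40 : 0 < k / 4 by rewrite divr_gt0.
  have := (@cvgrPdist_lt R 'M[R]_(n, 2) R _ (nbhs_filter 0) g (g 0)).1 gc _ k40.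
  apply: filterS => t gt.
  apply: (Per_le i k0) => j; rewrite -linearB/=.
  apply: le_trans (enorm_le_norm _) _.
  by have := norm_row_le (g 0 - g t) j; lra.
rewrite /local_minimiser_mod_rigid -g0 in cmin; have := gc _ cmin.
apply: filterS2 Xg => t Xgt /(_ _ Xgt); apply.
by exists 0, 0 => j; rewrite cos0 sin0 scale1r scale0r addr0 add0r.
Qed.
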